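(* For every fixed finite field $\mathbb{F}_q$ with $q\ge 3$ there exist constants $\epsilon,\delta\in(0,1)$, depending only on $q$, such that: (i) for every prime power $n$, any depth three $\Sigma\Pi\Sigma$ circuit over $\mathbb{F}_q$ computing the polynomial $\mathrm{NW}_{n,\epsilon}(X)$ has size at least $2^{\delta n\log n}$; and (ii) for every even positive integer $n$, any depth three $\Sigma\Pi\Sigma$ circuit over $\mathbb{F}_q$ computing the polynomial $\mathrm{IMM}_{n,n}(X)$ has size at least $2^{\delta n\log n}$.
   Context: An arithmetic circuit over a field $\mathbb{F}$ is a directed acyclic graph whose internal nodes are labelled by addition or multiplication gates and whose leaves are labelled by variables or field elements; it computes a polynomial (as a formal polynomial) at its output gate. Its size is its number of nodes. A $\Sigma\Pi\Sigma$ circuit has an addition gate at the top, a middle layer of multiplication gates and a bottom layer of addition gates; with $s$ multiplication gates it computes a polynomial of the form $\sum_{i=1}^{s}\prod_{j=1}^{d_i}L_{i,j}(x_1,\dots,x_N)$, where each $L_{i,j}$ is an affine linear function over $\mathbb{F}$ (there is no restriction on the $d_i$). For a prime power $n$ and $0<\epsilon<1$, $\mathrm{NW}_{n,\epsilon}(X)$ is the polynomial in the $n^2$ variables $x_{ij}$, $i,j\in\{1,\dots,n\}$, over $\mathbb{F}_q$, defined by $$\mathrm{NW}_{n,\epsilon}(X)=\sum_{a(z)}x_{1a(1)}x_{2a(2)}\cdots x_{na(n)},$$ where $a(z)$ runs over all univariate polynomials in $\mathbb{F}_n[z]$ of degree $<\epsilon n$, and the field $\mathbb{F}_n$ with $n$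 elements is identified (by a fixed bijection) with $\{1,2,\dots,n\}$. $\mathrm{IMM}_{n,n}(X)$ is the $(1,1)$ entry of the product of $n$ generic $n\times n$ matrices $X^{(1)},\dots,X^{(n)}$ with disjoint sets of variables, $x^{(k)}_{ij}$ being the $(i,j)$ entry of $X^{(k)}$: $$\mathrm{IMM}_{n,n}(X)=\sum_{i_1,\dots,i_{n-1}\in[n]}x^{(1)}_{1i_1}x^{(2)}_{i_1i_2}\cdots x^{(n-1)}_{i_{n-2}i_{n-1}}x^{(n)}_{i_{n-1}1}.$$ *)

(* Defs.v *)
From HB Require Import structures.
From mathcomp Require Import all_boot all_order all_algebra.
From mathcomp Require Import mpoly.

Set Implicit Arguments.
Unset Strict Implicit.
Unset Printing Implicit Defensive.

Import Order.TTheory GRing.Theory Num.Theory.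
Local Open Scope ring_scope.

(* The label of a node, together with its incoming wires.  Parallel wires are
   allowed, so a multiplication gate may use an input several times.  The wires
   into an addition gate carry field coefficients (1 for a plain wire): this is
   what lets a bottom layer of addition gates compute arbitrary affine linear
   functions over F.  Coefficients are not counted in the size. *)
Inductive gate (F : Type) (N : nat) (V : Type) : Type :=
| Var of 'I_N
| Const of F
| Add of seq (F * V)
| Mul of seq V.

Arguments Var {F N V} _.
Arguments Const {F N V} _.
Arguments Add {F N V} _.
Arguments Mul {F N V} _.

Section Gates.
Variables (F : Type) (N : nat) (V : Type).
Implicit Type g : gate F N V.

Definition is_leaf g : bool :=
  match g with Var _ | Const _ => true | _ => false end.

Definition is_add g : bool := if g is Add _ then true else false.

Definition is_mul g : bool := if g is Mul _ then true else false.

Definition inputs g : seq V :=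
  match g with
  | Var _ | Const _ => [::]
  | Add s => [seq cu.2 | cu <- s]
  | Mul s => s
  end.

End Gates.

(* wire lab u v: u is an input of v. *)
Definition wire (F : Type) (N : nat) (V : eqType) (lab : V -> gate F N V) :
    rel V :=
  fun u v => u \in inputs (lab v).

Record circuit (F : Type) (N : nat) := Circuit {
  node : finType;
  lab : node -> gate F N node;
  output : node;
  circuit_internal : forall v, ~~ is_leaf (lab v) -> inputs (lab v) != [::];
  circuit_acyclic : forall c : seq node, cycle (wire lab) c -> c = [::]
}.

Definition circuit_size (F : Type) (N : nat) (C : circuit F N) : nat :=
  #|node C|.

Definition gate_value (F : fieldType) (N : nat) (V : Type)
    (val : V -> {mpoly F[N]}) (g : gate F N V) : {mpoly F[N]} :=
  match g with
  | Var i => 'X_i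
  | Const c => c%:MP
  | Add s => \sum_(cu <- s) cu.1 *: val cu.2
  | Mul s => \prod_(u <- s) val u
  end.

(* Since the circuit is acyclic, the gate equations have exactly one
   solution val. *)
Definition computes (F : fieldType) (N : nat) (C : circuit F N)
    (p : {mpoly F[N]}) : Prop :=
  exists2 val : node C -> {mpoly F[N]},
    (forall v, val v = gate_value val (lab v)) & val (output C) = p.

(* Layers: 0 is the top addition gate (the output), 1 the multiplication gates,
   2 the bottom addition gates, 3 the leaves; fan-ins are unbounded. *)
Definition SigmaPiSigma (F : Type) (N : nat) (C : circuit F N) : Prop :=
  exists layer : node C -> nat,
    [/\ forall v, (layer v == 0%N) = (v == output C),
        forall v, match layer v with
                  | 0 => is_add (lab v)
                  | 1 => is_mul (lab v)
                  | 2 => is_add (lab v)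
                  | 3 => is_leaf (lab v)
                  | _ => false
                  end
      & forall u v, wire (@lab _ _ C) u v -> layer u = (layer v).+1].

(* The n elements of K are identified with the indices 'I_n by the mutually
   inverse maps elt and idx.  As 0 < eps < 1, every polynomial of degree less
   than eps * n is in the finite type {poly_n K}; the zero polynomial, for
   which (size a).-1 = 0, is included. *)
Definition NW (F : fieldType) (R : realFieldType) (n : nat)
    (K : finFieldType) (elt : 'I_n -> K) (idx : K -> 'I_n) (eps : R) :
    {mpoly F[n * n]} :=
  \sum_(a : {poly_n K} | (size a).-1%:R < eps * n%:R)
    \prod_(i < n) 'X_(mxvec_index i (idx (val a).[elt i])).

Definition generic_mx (F : fieldType) (n : nat) (k : 'I_n) :
    'M[{mpoly F[n * (n * n)]}]_n :=
  \matrix_(i < n, j < n) 'X_(mxvec_index k (mxvec_index i j)).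

Definition IMM (F : fieldType) (n : nat) (n_gt0 : (0 < n)%N) :
    {mpoly F[n * (n * n)]} :=
  (\big[mulmx/1%:M]_(k < n) generic_mx F k)
    (Ordinal n_gt0) (Ordinal n_gt0).

(* Main.v *)
Require Import Defs.
From HB Require Import structures.
From mathcomp Require Import all_boot all_order all_algebra.
From mathcomp Require Import mpoly.
From mathcomp Require Import reals exp.
From mathcomp Require Import zify ring.

(* Grigoriev-Karpinski rank argument.  Let q = #|F| and k = n./2.  Both NW (with
   eps = 1/2) and IMM are sums of monomials having one letter in each of n blocks
   of variables, and both have n ^ k monomials that are distinguished by their
   letters in the k odd blocks as well as by those in the even blocks.  Consider
   the n ^ k derivatives of order k with respect to these odd letters.
   Fix a threshold t.  A product of affine forms whose linear parts have rank
   above t has all its derivatives of order k zero at a point where more than k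
   of the forms vanish, and few points fail this.  A product of rank at most t is
   a polynomial in t linear forms, so at each point its derivatives of order k
   lie in a fixed space of dimension 'C(k + t, k).  Hence if s gates suffice and
   s * 'C(k + t, k) < n ^ k, some nontrivial combination of the derivatives
   vanishes at all but a fraction s * 2 ^ k * (1 - 1 / 2q) ^ t of the points,
   whereas a nonzero multilinear polynomial of degree at most n is nonzero at a
   fraction at least 2 ^ - n of them.  The choice t ~ 4 q n log n concludes. *)

Set Implicit Arguments.
Unset Strict Implicit.
Unset Printing Implicit Defensive.

Import Order.TTheory GRing.Theory Num.Theory.
Local Open Scope ring_scope.

Lemma kernel_exists (F : fieldType) (A B : finType) (Q : A -> B -> F) :
  (#|A| < #|B|)%N ->
  exists2 c : B -> F, (exists b, c b != 0) &
    forall a, \sum_b c b * Q a b = 0.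
Proof.
move=> ltAB.
pose M := \matrix_(b < #|B|, a < #|A|) Q (enum_val a) (enum_val b).
have : kermx M != 0.
  by rewrite kermx_eq0 /row_free neq_ltn (leq_ltn_trans (rank_leq_col M)).
case/rowV0Pn=> v /sub_kermxP vM0 v0.
exists (fun b => v 0 (enum_rank b)).
  by case/rV0Pn: v0 => i vi; exists (enum_val i); rewrite enum_valK.
move=> a; have /rowP/(_ (enum_rank a)) := vM0.
rewrite !mxE => vMa; rewrite -[RHS]vMa (reindex (@enum_val B predT)) /=; last first.
  by apply: onW_bij; apply: enum_val_bij.
by apply: eq_bigr => i _; rewrite !mxE enum_valK enum_rankK.
Qed.

(** * Points at which few affine forms vanish *)

Section Count.
Variable F : finFieldType.
Local Notation q := #|F|.

(* Exponential weight for a Chernoff bound on the number of zero coordinates. *)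
Definition weight r (y : 'cV[F]_r) : nat :=
  \prod_i (if y i 0%R == 0%R then 1%N else 2)%N.

(** The sum factors over the coordinates, each of which gives 1 for the zero scalar and 2 for each
    of the [q - 1] others. *)
Lemma sum_weight r : (\sum_(y : 'cV[F]_r) weight y = (2 * q).-1 ^ r)%N.
Proof.
have w1 : (\sum_(c : F) (if c == 0%R then 1 else 2) = (2 * q).-1)%N.
  rewrite (bigD1 0%R) //= eqxx (eq_bigr (fun=> 2%N)); last first.
    by move=> c /negbTE ->.
  rewrite sum_nat_const.
  have -> : #|[pred c : F | c != 0]| = q.-1 by rewrite cardC1.
  have : (0 < q)%N by apply/card_gt0P; exists 0%R.
  by case: #|F| => [//|m] _; lia.
transitivity (\prod_(i < r) \sum_(c : F) (if c == 0%R then 1 else 2))%N; last first.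
  by rewrite w1 prod_nat_const card_ord.
rewrite bigA_distr_bigA /=.
rewrite (reindex (fun f : {ffun 'I_r -> F} => (\col_i f i)%R)) /=.
  by apply: eq_bigr => f _; apply: eq_bigr => i _; rewrite mxE.
exists (fun y : 'cV[F]_r => [ffun i => y i 0%R]) => [f _|y _].
  by apply/ffunP => i; rewrite ffunE mxE.
by apply/colP => i; rewrite mxE ffunE.
Qed.

(** Shifting [x] by [R *m z] shifts [A *m x + b] by [z], so [A *m x + b] is equidistributed. Both
    sides arise from one sum over pairs of [z] and [x]. *)
Lemma sum_affine_right_inverse r N (A : 'M[F]_(r, N)) (R : 'M[F]_(N, r))
    (b : 'cV[F]_r) (g : 'cV[F]_r -> nat) : A *m R = 1%:M ->
  (q ^ r * (\sum_(x : 'cV[F]_N) g (A *m x + b)%R) =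
   q ^ N * \sum_(y : 'cV[F]_r) g y)%N.
Proof.
move=> AR.
have cE n : (q ^ n)%N = #|{: 'cV[F]_n}| by rewrite card_mx muln1.
rewrite [in LHS]cE [in RHS]cE -!sum_nat_const.
transitivity (\sum_(z : 'cV[F]_r) \sum_(x : 'cV[F]_N) g (A *m x + b + z)%R)%N.
  apply: eq_bigr => z _.
  rewrite (reindex_inj (addIr (R *m z))) /=; apply: eq_bigr => x _.
  by rewrite mulmxDr mulmxA AR mul1mx addrAC.
rewrite exchange_big; apply: eq_bigr => x _ /=.
by rewrite [RHS](reindex_inj (addrI (A *m x + b))).
Qed.

Definition zeros d (y : 'cV[F]_d) : nat := \sum_i (y i 0%R == 0%R).

Lemma weight_zeros r (y : 'cV[F]_r) : (weight y * 2 ^ zeros y = 2 ^ r)%N.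
Proof.
rewrite /weight /zeros expn_sum -big_split /=.
transitivity (\prod_(i < r) 2)%N; last by rewrite prod_nat_const card_ord.
by apply: eq_bigr => i _; case: eqP.
Qed.

(** Markov's inequality for [weight] on [r] independent rows, [r] being the rank: [2 ^ k * weight]
    is at least [2 ^ r] on the set, while [weight] has mean [((2 * q).-1 / q) ^ r]. *)
Lemma few_zeros_count N d (A : 'M[F]_(d, N)) (b : 'cV[F]_d) k t :
  (t <= \rank A)%N ->
  (#|[set x : 'cV[F]_N | (zeros (A *m x + b)%R <= k)%N]| * (2 * q) ^ t
     <= 2 ^ k * q ^ N * (2 * q).-1 ^ t)%N.
Proof.
set E := [set x | _]; set r := \rank A => le_tr.
have q_gt0 : (0 < q)%N by apply/card_gt0P; exists 0%R.
(* The bound for the full rank [r] implies the one for [t], as [(2 * q).-1 <= 2 * q]. *)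
suff H : (#|E| * (2 * q) ^ r <= 2 ^ k * q ^ N * (2 * q).-1 ^ r)%N.
  rewrite -(@leq_pmul2r ((2 * q) ^ (r - t))) ?expn_gt0 ?muln_gt0 ?q_gt0 //.
  rewrite -mulnA -expnD subnKC //; apply: leq_trans H _.
  have -> : ((2 * q).-1 ^ r = (2 * q).-1 ^ t * (2 * q).-1 ^ (r - t))%N.
    by rewrite -expnD subnKC.
  rewrite mulnA leq_mul2l; apply/orP; right.
  by have [->|rt0] := posnP (r - t); rewrite ?expn0 ?leq_exp2r ?leq_pred.
(* Keeping a maximal set of independent rows can only lower the number of zeros, and provides a
   right inverse. *)
pose h := maxrankfun A.
pose A' := rowsub h A; pose b' := rowsub h b.
have /row_freeP [R AR] : row_free A' by apply: maxrowsub_free.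
have zle x : (zeros (A' *m x + b')%R <= zeros (A *m x + b)%R)%N.
  have -> : A' *m x + b' = rowsub h (A *m x + b).
    by apply/colP => i; rewrite !mxE; congr (_ + _); apply: eq_bigr => j _;
       rewrite !mxE.
  rewrite /zeros; set y := A *m x + b.
  apply: (@leq_trans (\sum_(j in h @: setT) (y j 0%R == 0%R))).
    rewrite big_imset /=; last by move=> i j _ _; apply: maxrankfun_inj.
    by apply/eq_leq/eq_big => [i|i _]; rewrite ?inE // mxE.
  by rewrite [leqRHS](bigID (mem (h @: setT))) /= leq_addr.
have := sum_affine_right_inverse b' (@weight r) AR.
rewrite sum_weight => sumE.
rewrite -mulnA -sumE expnMn -[(\rank A)]/r !mulnA (mulnAC (2 ^ k)%N).
rewrite leq_mul2r.
apply/orP; right.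
rewrite -sum_nat_const big_distrr /=.
apply: (@leq_trans (\sum_(x in E) 2 ^ k * weight (A' *m x + b')%R)%N).
  apply: leq_sum => x; rewrite inE => xE.
  rewrite -(weight_zeros (A' *m x + b')%R) mulnC leq_mul2r leq_exp2l //.
  by rewrite (leq_trans (zle x) xE) orbT.
by rewrite [leqRHS](bigID (mem E)) /= leq_addr.
Qed.

End Count.

(** * Expansion of products of affine forms at a point *)

Section Translate.
Variables (F : fieldType) (N : nat).

Definition linform (v : 'rV[F]_N) : {mpoly F[N]} := \sum_i v 0 i *: 'X_i.

Definition affform (v : 'rV[F]_N) (b : F) : {mpoly F[N]} := b%:MP + linform v.

(* p (x + X): its coefficients are the Hasse derivatives of p at x, so that no
   chain rule or Leibniz rule is needed for products of affine forms. *)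
Definition translate (x : 'cV[F]_N) (p : {mpoly F[N]}) : {mpoly F[N]} :=
  p \mPo [tuple (x i 0)%:MP + 'X_i | i < N].

HB.instance Definition _ x := GRing.RMorphism.copy (translate x)
  (comp_mpoly [tuple (x i 0)%:MP + 'X_i | i < N]).

Lemma translateX x i : translate x 'X_i = (x i 0)%:MP + 'X_i.
Proof. by rewrite /translate comp_mpolyXU -tnth_nth tnth_mktuple. Qed.

Lemma translateZ x c p : translate x (c *: p) = c *: translate x p.
Proof. exact: comp_mpolyZ. Qed.

Lemma linform_homog v : linform v \is 1.-homog.
Proof.
by apply: rpred_sum => i _; apply: rpredZ; rewrite dhomogX /= mdeg1.
Qed.

Lemma translate_affform x v b :
  translate x (affform v b) = affform v ((v *m x) 0 0 + b).
Proof.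
rewrite /affform rmorphD /= rmorph_sum /= {1}/translate comp_mpolyC.
rewrite addrC mpolyCD -addrA [b%:MP + _]addrC addrA; congr (_ + _).
rewrite mxE rmorph_sum /= -big_split; apply: eq_bigr => i _ /=.
by rewrite translateZ translateX scalerDr -mul_mpolyC mpolyCM.
Qed.

(** The order of vanishing of [p] at the origin is at least [k]; applied to [translate x p], this is
    the order at [x]. *)
Definition vanish_below k (p : {mpoly F[N]}) := forall m, (mdeg m < k)%N -> p@_m = 0.

Lemma vanish_belowM j k p p' :
  vanish_below j p -> vanish_below k p' -> vanish_below (j + k) (p * p').
Proof.
move=> vp vp' m ltm; rewrite mcoeffM big1 // => -[a b] /= /eqP def_m.
have [lta|lea] := ltnP (mdeg a) j; first by rewrite vp ?mul0r.
have mdE : mdeg m = (mdeg a + mdeg b)%N by rewrite {1}def_m mdegD.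
by rewrite vp' ?mulr0 //; lia.
Qed.

(** A form with zero constant term has order at least 1 at the origin, and orders add under
    products. *)
Lemma vanish_below_prod (I : Type) (r : seq I) (b : I -> F)
    (v : I -> 'rV[F]_N) :
  vanish_below (\sum_(i <- r) (b i == 0%R)) (\prod_(i <- r) affform (v i) (b i)).
Proof.
elim: r => [|i r IHr]; first by rewrite !big_nil.
rewrite !big_cons; apply: vanish_belowM => // m.
case: eqP => [b0|_] //=; rewrite ltnS leqn0 => /eqP m0.
rewrite /affform b0 add0r; apply: (dhomog_nemf_coeff (linform_homog _)).
by rewrite /= m0.
Qed.

Lemma comp_linform_coef t (lam : 'I_t -> {mpoly F[N]}) (a : 'X_{1..t}) m :
  (forall i, lam i \is 1.-homog) -> mdeg m != mdeg a ->
  ('X_[a] \mPo [tuple lam i | i < t])@_m = 0.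
Proof.
move=> lam1 ma; apply: (dhomog_nemf_coeff _ ma) => /=.
rewrite comp_mpolyX mdegE.
rewrite (eq_bigr (fun i => lam i ^+ a i)); last first.
  by move=> i _; rewrite tnth_mktuple.
elim/big_ind2: _ => [|d1 p1 d2 p2 h1 h2|i _]; first exact: dhomog1.
  exact: dhomogM.
by rewrite -[X in X.-homog]mul1n; apply: dhomogMn.
Qed.

Lemma comp_prod_affform t d (B : 'M[F]_(d, t)) (L : 'M[F]_(t, N)) (b : 'I_d -> F) :
  \prod_i affform (row i (B *m L)) (b i) =
  (\prod_i ((b i)%:MP + \sum_(r < t) B i r *: 'X_r)) \mPo
    [tuple linform (row r L) | r < t].
Proof.
rewrite rmorph_prod; apply: eq_bigr => i _ /=.
rewrite rmorphD /= comp_mpolyC; congr (_ + _).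
rewrite rmorph_sum /= /linform.
under [RHS]eq_bigr do rewrite comp_mpolyZ comp_mpolyXU -tnth_nth tnth_mktuple scaler_sumr.
rewrite exchange_big; apply: eq_bigr => j _ /=.
rewrite !mxE scaler_suml; apply: eq_bigr => r _.
by rewrite !mxE scalerA.
Qed.

Lemma lowrank_factor t d (A : 'M[F]_(d, N)) : (\rank A <= t)%N ->
  exists (B : 'M[F]_(d, t)) (L : 'M[F]_(t, N)), A = B *m L.
Proof.
move=> leAt; exists (col_base A *m pid_mx (\rank A)), (pid_mx (\rank A) *m row_base A).
by rewrite -mulmxA (mulmxA (pid_mx _)) pid_mx_id // pid_mx_1 mul1mx mulmx_base.
Qed.

(** Substituting linear forms preserves degrees, so only the degree [k] part of [Phi] reaches the
    coefficients at [mon m]. The condition on [c] involves [L] alone, hence it serves all constant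
    terms [b] at once. *)
Lemma lowrank_functional t d (B : 'M[F]_(d, t)) (L : 'M[F]_(t, N))
    (M : finType) (k : nat) (mon : M -> 'X_{1..N}) (c : M -> F) (b : 'I_d -> F) :
  (forall m, mdeg (mon m) = k) ->
  (forall a : 'X_{1..t}, mdeg a = k ->
    \sum_m c m * ('X_[a] \mPo [tuple linform (row r L) | r < t])@_(mon m) = 0) ->
  \sum_m c m * (\prod_i affform (row i (B *m L)) (b i))@_(mon m) = 0.
Proof.
move=> mon_k c0; rewrite comp_prod_affform; set Phi := \prod_i _.
under eq_bigr do rewrite comp_mpolyEX raddf_sum /= mulr_sumr.
rewrite exchange_big big1_seq //= => a _.
under eq_bigr do rewrite mcoeffZ mulrCA.
rewrite -mulr_sumr; have [ak|ak] := eqVneq (mdeg a) k.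
  by rewrite c0 ?mulr0.
rewrite big1 ?mulr0 // => m _.
rewrite comp_linform_coef ?mulr0 ?mon_k 1?eq_sym // => r.
exact: linform_homog.
Qed.

End Translate.

(** * Low rank and high rank products *)

Section Core.
Variables (F : finFieldType) (N : nat).
Local Notation q := #|F|.

Lemma depth3_alternative (J M : finType) (d : J -> nat)
    (A : forall j, 'M[F]_(d j, N)) (b : forall j, 'cV[F]_(d j)) (cf : J -> F)
    (f : {mpoly F[N]}) (mon : M -> 'X_{1..N}) (k t : nat) :
  f = \sum_j cf j *: \prod_i affform (row i (A j)) (b j i 0) ->
  (forall m, mdeg (mon m) = k) ->
  (#|J| * 'C(k + t, k) < #|M|)%N ->
  exists2 c : M -> F, (exists m, c m != 0) &
    (#|[set x : 'cV[F]_N | (\sum_m c m * (translate x f)@_(mon m) != 0)%R]|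
       * (2 * q) ^ t.+1 <= #|J| * (2 ^ k * q ^ N * (2 * q).-1 ^ t.+1))%N.
Proof.
move=> def_f mon_k ltM.
(* The threshold is [t.+1] because ['C(k + t, k)] is the number of monomials of degree [k] in [t.+1]
   variables. *)
pose low j := (\rank (A j) <= t.+1)%N.
have /fin_all_exists [L defL] : forall j, exists L : 'M[F]_(t.+1, N),
    low j -> exists B, A j = B *m L.
  move=> j; case lowj: (low j); last by exists 0.
  by have [B [L AE]] := lowrank_factor lowj; exists L => _; exists B.
pose bas := [seq s2m x | x : k.-tuple 'I_t.+1 <- enum (basis t.+1 k)].
(* One equation per product and per monomial of degree [k]. The point [x] does not occur, since
   translation changes only the constant terms: a single [c] serves all points. *)
pose Q (ja : J * 'I_('C(k + t, k))) (m : M) :=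
  ('X_[nth 0%MM bas ja.2] \mPo [tuple linform (row r (L ja.1)) | r < t.+1])@_(mon m).
have [|c c_neq0 c_ker] := @kernel_exists F _ M Q.
  by rewrite card_prod card_ord.
exists c => //.
have vanish_low x j : low j ->
    \sum_m c m * (\prod_i affform (row i (A j)) ((A j *m x + b j) i 0))@_(mon m) = 0.
  move=> /defL [B ->].
  have := @lowrank_functional _ _ _ _ B (L j) _ _ mon c
    (fun i => (B *m L j *m x + b j) i 0) mon_k; apply => a ak.
  have abas : a \in bas by rewrite -basis_cover ak.
  have ltai : (index a bas < 'C(k + t, k))%N by rewrite -size_basis index_mem.
  by have := c_ker (j, Ordinal ltai); rewrite /Q /= nth_index.
pose bad j := [set x : 'cV[F]_N | (zeros (A j *m x + b j)%R <= k)%N].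
(* A nonzero value at x needs a high-rank product with few zeros at x. *)
have sub : [set x : 'cV[F]_N | \sum_m c m * (translate x f)@_(mon m) != 0]
    \subset \bigcup_(j | ~~ low j) bad j.
  apply/subsetP => x; rewrite inE; apply: contraR => /bigcupP x_good.
  rewrite def_f.
  under eq_bigr do rewrite rmorph_sum raddf_sum /= mulr_sumr.
  rewrite exchange_big big1 //= => j _.
  under eq_bigr do rewrite translateZ mcoeffZ mulrCA rmorph_prod /=.
  rewrite -mulr_sumr (eq_bigr (fun m => c m *
     (\prod_i affform (row i (A j)) ((A j *m x + b j) i 0))@_(mon m))); last first.
    move=> m _; congr (_ * mcoeff _ _); apply: eq_bigr => i _.
    by rewrite translate_affform -row_mul !mxE.
  have [lowj|highj] := boolP (low j); first by rewrite vanish_low ?mulr0.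
  rewrite big1 ?mulr0 // => m _.
  rewrite (vanish_below_prod (fun i => row i (A j))) ?mulr0 // mon_k ltnNge.
  by apply/negP => badj; apply: x_good; exists j; rewrite ?inE.
apply: leq_trans (leq_mul (subset_leq_card sub) (leqnn _)) _.
apply: (@leq_trans ((\sum_(j | ~~ low j) #|bad j|) * (2 * q) ^ t.+1)).
  rewrite leq_mul2r; apply/orP; right.
  elim/big_ind2: _ => [|m1 B1 m2 B2 le1 le2|//]; first by rewrite cards0.
  by rewrite cardsU (leq_trans (leq_subr _ _)) ?leq_add.
rewrite big_distrl /= -sum_nat_const [leqRHS](bigID low) /=.
apply: leq_trans (leq_addl _ _); apply: leq_sum => j.
by rewrite -ltnNge => /ltnW; apply: few_zeros_count.
Qed.

End Core.

(** The translates of the set by the vectors [- e i] cover the space, and all have its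
    cardinality. *)
Lemma shift_cover_count (F : finFieldType) (N : nat) (I : finType)
    (P : pred 'cV[F]_N) (e : I -> 'cV[F]_N) :
  (forall x, exists i, P (x + e i)) ->
  (#|F| ^ N <= #|I| * #|[set x | P x]|)%N.
Proof.
move=> cover.
have -> : (#|F| ^ N)%N = #|{: 'cV[F]_N}| by rewrite card_mx muln1.
rewrite -sum_nat_const.
apply: (@leq_trans #|\bigcup_i [set x | P (x + e i)]|).
  apply/subset_leq_card/subsetP => x _; have [i Pxi] := cover x.
  by apply/bigcupP; exists i; rewrite ?inE.
have cardE i : #|[set x | P x]| = #|[set x | P (x + e i)]|.
  rewrite -[RHS](card_imset [set x | P (x + e i)] (addIr (e i))).
  apply: eq_card => y; rewrite inE.
  apply/idP/imsetP => [Py|[x Px ->]]; last by rewrite inE in Px.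
  by exists (y - e i); rewrite ?inE subrK.
under [leqRHS]eq_bigr => i _ do rewrite (cardE i).
elim/big_ind2: _ => [|m1 B1 m2 B2 le1 le2|//]; first by rewrite cards0.
by rewrite cardsU (leq_trans (leq_subr _ _)) ?leq_add.
Qed.

Lemma sum_odd_ord n : (\sum_(i < n | odd i) 1 = n./2)%N.
Proof.
elim: n => [|n IHn]; first by rewrite big_ord0.
rewrite big_mkcond big_ord_recr /= -big_mkcond IHn uphalf_half.
by case: odd; rewrite addnC.
Qed.

(** * Set-multilinear polynomials *)

Section SetMultilinear.
Variables (F : finFieldType) (N n : nat) (blk : 'I_N -> 'I_n).
Local Notation q := #|F|.

Lemma sum_word_coef w (J : {set 'I_n}) v : cancel w blk ->
  (\sum_(i in J) U_(w i))%MM v = ((blk v \in J) && (w (blk v) == v)).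
Proof.
move=> wK; rewrite mnm_sumE; have [bJ|bJ] := boolP (blk v \in J); last first.
  rewrite big1 // => i iJ; rewrite mnm1E; case: eqP => // wv.
  by rewrite -wv wK iJ in bJ.
rewrite (bigD1 (blk v)) //= mnm1E big1 ?addn0 // => i /andP [_ ib].
by rewrite mnm1E; case: eqP => // wv; rewrite -wv wK eqxx in ib.
Qed.

Lemma eq_sum_word w w' (J K : {set 'I_n}) :
  cancel w blk -> cancel w' blk ->
  (\sum_(i in J) U_(w i) == \sum_(i in K) U_(w' i))%MM =
  (J == K) && [forall i in K, w i == w' i].
Proof.
move=> wK w'K; apply/eqP/andP => [eq_sum|[/eqP -> /forall_inP ww']]; last first.
  by apply: eq_bigr => i /ww' /eqP ->.
have coefE v : (blk v \in J) && (w (blk v) == v) = (blk v \in K) && (w' (blk v) == v).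
  by apply: (can_inj oddb); rewrite -!sum_word_coef // eq_sum.
have JK i : i \in J = (i \in K).
  apply/idP/idP => iA.
    by have := coefE (w i); rewrite wK iA eqxx => /esym/andP[].
  by have := coefE (w' i); rewrite w'K iA eqxx => /andP[].
split; first exact/eqP/setP.
apply/forall_inP => i iK; have := coefE (w' i).
by rewrite w'K iK eqxx => /andP[].
Qed.

(** Expanding the product gives one term per set [J] of blocks that keep their variable; by
    [eq_sum_word] only [J = K] can yield the required monomial. *)
Lemma translate_word_coef (x : 'cV[F]_N) w w' (K : {set 'I_n}) :
  cancel w blk -> cancel w' blk ->
  (translate x (\prod_i 'X_(w i)))@_(\sum_(i in K) U_(w' i))%MM =
  [forall i in K, w i == w' i]%:R * \prod_(i in ~: K) x (w i) 0.
Proof.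
move=> wK w'K.
have XE (J : {set 'I_n}) :
    \prod_(i in J) 'X_(w i) = 'X_[F, \sum_(i in J) U_(w i)] :> {mpoly F[N]}.
  by rewrite (big_morph _ (@mpolyXD _ _) (@mpolyX0 _ _)).
move Emu: (\sum_(i in K) _)%MM => mu; rewrite rmorph_prod /=.
rewrite (eq_bigr (fun i => 'X_(w i) + (x (w i) 0)%:MP)) => [|i _]; last first.
  by rewrite translateX addrC.
rewrite bigA_distr raddf_sum /= (bigD1 K) //= [X in _ + X]big1 => [|J JK].
  rewrite addr0 (bigID (mem K)) /=.
  rewrite (eq_bigr (fun i => 'X_(w i))) => [|i ->//].
  rewrite [X in _ * X](eq_bigr (fun i => (x (w i) 0)%:MP)) => [|i /negbTE ->//].
  rewrite -rmorph_prod /= mulrC mcoeffCM XE mcoeffX -Emu eq_sum_word //.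
  rewrite eqxx mulrC /=; congr (_ * _); apply: eq_bigl => i.
  by rewrite inE.
rewrite (bigID (mem J)) /=.
rewrite (eq_bigr (fun i => 'X_(w i))) => [|i ->//].
rewrite [X in _ * X](eq_bigr (fun i => (x (w i) 0)%:MP)) => [|i /negbTE ->//].
rewrite -rmorph_prod /= mulrC mcoeffCM XE mcoeffX -Emu eq_sum_word //.
by rewrite (negbTE JK) mulr0.
Qed.

(* Words w with P w index the monomials of f, ltr w i being the letter of w in
   block i; the derivatives are taken along the S-letters of the words e m. *)
Variables (W M : finType) (P : pred W) (ltr : W -> 'I_n -> 'I_N) (e : M -> W).
Variable (S : {set 'I_n}).
Hypothesis ltrK : forall w, cancel (ltr w) blk.
Hypothesis P_e : forall m, P (e m).
Hypothesis S_inj : forall m m',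
  {in S, forall i, ltr (e m) i = ltr (e m') i} -> m = m'.
Hypothesis SC_inj : forall m w, P w ->
  {in ~: S, forall i, ltr (e m) i = ltr w i} -> e m = w.

Let f : {mpoly F[N]} := \sum_(w | P w) \prod_i 'X_(ltr w i).
Let mon m : 'X_{1..N} := (\sum_(i in S) U_(ltr (e m) i))%MM.
Let g (c : M -> F) x := \sum_m c m * (translate x f)@_(mon m).

(* The alternating sum of g over the cube spanned at x by the letters of e m0
   outside S is, up to sign, the coefficient in g of their product, c m0. *)
Lemma setmultilinear_cube_sum (c : M -> F) m0 x :
  c m0 != 0 ->
  exists T : {set 'I_n},
    g c (x + \sum_(i in T) delta_mx (ltr (e m0) i) 0) != 0.
Proof.
move=> cm0; pose u := ltr (e m0).
(* This is [(-1) ^+ #|T|] if [T] avoids [S] and 0 otherwise. Written as a product over blocks, it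
   lets the sum over all [T] be distributed. *)
pose sg (T : {set 'I_n}) : F := \prod_i (if i \in T then - (i \notin S)%:R else 1).
have shiftE (w : W) (T : {set 'I_n}) :
    sg T * \prod_(i in ~: S) (x + \sum_(i in T) delta_mx (u i) 0) (ltr w i) 0 =
    \prod_i (if i \in T then - ((i \notin S)%:R * (x (ltr w i) 0 + (ltr w i == u i)%:R))
             else if i \in S then 1 else x (ltr w i) 0).
  rewrite /sg [X in _ * X]big_mkcond -big_split; apply: eq_bigr => i _ /=.
  rewrite inE; have [iS|iS] := boolP (i \in S).
    by rewrite mulr1 mul0r.
  rewrite !mxE summxE.
  have -> : \sum_(j in T) delta_mx (u j) 0 (ltr w i) (0 : 'I_1) =
            ((i \in T) && (ltr w i == u i))%:R :> F.
    have [iT|iT] := boolP (i \in T); last first.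
      rewrite big1 // => j jT; rewrite mxE andbT; case: eqP => // uw.
      have /esym := congr1 blk uw; rewrite !ltrK => ji.
      by rewrite -ji jT in iT.
    rewrite (bigD1 i) //= mxE andbT big1 ?addr0 // => j /andP[_ ji].
    rewrite mxE andbT; case: eqP => // uw.
    have /esym := congr1 blk uw; rewrite !ltrK => ji'.
    by rewrite ji' eqxx in ji.
  by case: (i \in T); rewrite /= ?addr0 !mul1r ?mulN1r.
(* Each block [i] outside [S] contributes the difference of the values of its letter before and
   after the shift, the latter being larger by 1 exactly when [ltr w i] is [u i]. *)
have wordE w : \sum_(T : {set 'I_n})
    sg T * \prod_(i in ~: S) (x + \sum_(i in T) delta_mx (u i) 0) (ltr w i) 0 =
    \prod_(i in ~: S) - (ltr w i == u i)%:R.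
  under [LHS]eq_bigr do rewrite shiftE.
  rewrite -bigA_distr [RHS]big_mkcond; apply: eq_bigr => i _ /=.
  rewrite inE; case: (i \in S); first by rewrite mul0r oppr0 add0r.
  by rewrite mul1r opprD addrAC addNr add0r.
have gE T : g c T = \sum_m c m * \sum_(w | P w)
    [forall i in S, ltr w i == ltr (e m) i]%:R *
    \prod_(i in ~: S) T (ltr w i) 0.
  apply: eq_bigr => m _; rewrite rmorph_sum raddf_sum /=; congr (_ * _).
  by apply: eq_bigr => w _; rewrite translate_word_coef.
have kill w : ~~ [forall i in ~: S, ltr w i == u i] ->
    \prod_(i in ~: S) - (ltr w i == u i)%:R = 0 :> F.
  rewrite negb_forall_in => /exists_inP [i iS wu].
  by rewrite (bigD1 i) //= (negbTE wu) oppr0 mul0r.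
have sgE m : \sum_(T : {set 'I_n}) sg T * (c m * \sum_(w | P w)
      [forall i in S, ltr w i == ltr (e m) i]%:R *
      \prod_(i in ~: S) (x + \sum_(i in T) delta_mx (u i) 0) (ltr w i) 0) =
    c m * \sum_(w | P w) [forall i in S, ltr w i == ltr (e m) i]%:R *
      \prod_(i in ~: S) - (ltr w i == u i)%:R.
  under [LHS]eq_bigr do rewrite mulrCA mulr_sumr.
  rewrite -mulr_sumr exchange_big /=; congr (_ * _).
  apply: eq_bigr => w _; under [LHS]eq_bigr do rewrite mulrCA.
  by rewrite -mulr_sumr wordE.
have sumE : \sum_(T : {set 'I_n}) sg T * g c (x + \sum_(i in T) delta_mx (u i) 0)
    = c m0 * (-1) ^+ #|~: S|.
  under eq_bigr do rewrite gE mulr_sumr.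
  rewrite exchange_big /=; under eq_bigr do rewrite sgE.
  (* By [SC_inj] the letters outside [S] leave only the word [e m0] among all words of [f]; its
     letters in [S] then leave only [m0], by [S_inj]. *)
  rewrite (bigD1 m0) //= [X in _ + X]big1 ?addr0 => [|m mm0].
    rewrite (bigD1 (e m0)) //= [X in _ + X]big1 => [|w /andP[Pw wm0]]; last first.
      rewrite kill ?mulr0 //; apply: contra wm0 => /forall_inP wu.
      by apply/eqP/esym/SC_inj => // i /wu /eqP.
    rewrite [X in nat_of_bool X](_ : _ = true); last by apply/forall_inP.
    rewrite mul1r addr0 (eq_bigr (fun=> -1)) => [|i _]; last by rewrite eqxx.
    by rewrite prodr_const.
  rewrite big1 ?mulr0 // => w Pw.
  have [/forall_inP wu|] := boolP [forall i in ~: S, ltr w i == u i]; last first.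
    by move=> /kill ->; rewrite mulr0.
  have def_w : e m0 = w by apply: SC_inj => // i /wu /eqP.
  case: forall_inP => [wm|]; last by rewrite mul0r.
  by case/eqP: mm0; apply: S_inj => i /wm /eqP; rewrite def_w.
apply/existsP; apply: contraT; rewrite negb_exists => /forallP g0.
have : c m0 * (-1) ^+ #|~: S| != 0 by rewrite mulf_neq0 ?signr_eq0.
rewrite -sumE big1 ?eqxx // => T _.
by have /negPn /eqP -> := g0 T; rewrite mulr0.
Qed.

(** If the first alternative fails, [depth3_alternative] bounds the number of nonzeros of [g c] from
    above, while their translates along the [2 ^ n] sets [T] cover the space. The factor [q ^ N]
    cancels. *)
Lemma setmultilinear_depth3 (J : finType) (d : J -> nat)
    (A : forall j, 'M[F]_(d j, N)) (b : forall j, 'cV[F]_(d j)) (cf : J -> F)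
    (t : nat) :
  f = \sum_j cf j *: \prod_i affform (row i (A j)) (b j i 0) ->
  (#|M| <= #|J| * 'C(#|S| + t, #|S|))%N \/
  ((2 * q) ^ t.+1 <= #|J| * 2 ^ (n + #|S|) * (2 * q).-1 ^ t.+1)%N.
Proof.
move=> def_f; have [leM|ltM] := leqP; [by left | right].
have mon_k m : mdeg (mon m) = #|S|.
  rewrite /mon mdeg_sum -sum1_card; apply: eq_bigr => i _; exact: mdeg1.
have [c [m0 cm0] few] := depth3_alternative def_f mon_k ltM.
have := shift_cover_count (P := fun x => g c x != 0)
  (fun x => setmultilinear_cube_sum x cm0).
rewrite -[#|{set 'I_n}|]cardsT -powersetT card_powerset cardsT card_ord => many.
have q_gt0 : (0 < q ^ N)%N by rewrite expn_gt0; apply/orP; left; apply/card_gt0P; exists 0.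
rewrite -(leq_pmul2l q_gt0).
apply: leq_trans (leq_mul many (leqnn _)) _; rewrite -mulnA.
apply: leq_trans (leq_mul (leqnn _) few) _.
by apply/eq_leq; rewrite expnD; ring.
Qed.

End SetMultilinear.

(** * From circuits to sums of products of affine forms *)

Section Circuit.
Variables (F : fieldType) (N : nat).

Lemma affform_sum (I : Type) (r : seq I) (c : I -> F) (p : I -> {mpoly F[N]}) :
  (forall i, exists v b, p i = affform v b) ->
  exists v b, \sum_(i <- r) c i *: p i = affform v b.
Proof.
move=> affp; elim: r => [|i r [v [b IHr]]].
  exists 0, 0; rewrite big_nil /affform /linform mpolyC0 add0r big1 // => i _.
  by rewrite mxE scale0r.
have [v' [b' pE]] := affp i.
exists (c i *: v' + v), (c i * b' + b); rewrite big_cons IHr pE.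
rewrite /affform scalerDr addrACA mpolyCD mpolyCM mul_mpolyC; congr (_ + _).
rewrite /linform scaler_sumr -big_split; apply: eq_bigr => j _ /=.
by rewrite !mxE scalerDl scalerA.
Qed.

Variables (C : circuit F N) (layer : node C -> nat) (val : node C -> {mpoly F[N]}).
Hypothesis layer0 : forall v, (layer v == 0%N) = (v == output C).
Hypothesis layer_gate : forall v, match layer v with
                  | 0 => is_add (lab v)
                  | 1 => is_mul (lab v)
                  | 2 => is_add (lab v)
                  | 3 => is_leaf (lab v)
                  | _ => false
                  end.
Hypothesis layer_wire :
  forall u v, wire (@lab _ _ C) u v -> layer u = (layer v).+1.
Hypothesis valE : forall v, val v = gate_value val (lab v).

Lemma layer2_affform v : layer v = 2 -> exists r b, val v = affform r b.
Proof.
move=> lv; have := layer_gate v; rewrite lv valE.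
have leaf u : u \in inputs (lab v) -> exists r b, val u = affform r b.
  move=> /layer_wire; rewrite lv => lu; have := layer_gate u.
  rewrite lu valE; case: (lab u) => //= [i|c] _; last first.
    by exists 0, c; rewrite /affform /linform big1 ?addr0 // => j _;
      rewrite mxE scale0r.
  exists (delta_mx 0 i), 0.
  rewrite /affform /linform mpolyC0 add0r (bigD1 i) //= mxE !eqxx scale1r.
  by rewrite big1 ?addr0 // => j /negbTE ji; rewrite mxE ji scale0r.
case: (lab v) leaf => //= s leaf _.
(* [affform_sum] asks for affine values at every index, so a default form is used off the list of
   inputs. *)
have -> : \sum_(cu <- s) cu.1 *: val cu.2 =
    \sum_(cu <- s) cu.1 *: (if cu.2 \in map snd s then val cu.2 else affform 0 0).
  by apply: eq_big_seq => cu cus; rewrite map_f.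
by apply: affform_sum => cu; case: ifP => [/leaf //|_]; exists 0, 0.
Qed.

Lemma layer1_product v : layer v = 1%N ->
  exists D : {d & ('M[F]_(d, N) * 'cV[F]_d)%type},
    val v = \prod_i affform (row i (tagged D).1) ((tagged D).2 i 0).
Proof.
move=> lv; have := layer_gate v; rewrite lv [val v]valE.
have aff u : u \in inputs (lab v) -> exists rb, val u = affform rb.1 rb.2.
  move=> /layer_wire; rewrite lv => /layer2_affform [r [b ->]].
  by exists (r, b).
case: (lab v) aff => //= s aff _.
have /fin_all_exists [rb rbE] i : exists rb, val (tnth (in_tuple s) i) = affform rb.1 rb.2.
  by apply: aff; apply: mem_tnth.
exists (existT _ (size s) (\matrix_i (rb i).1, \col_i (rb i).2)) => /=.
rewrite big_tnth; apply: eq_bigr => i _; rewrite rbE.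
by rewrite rowK mxE.
Qed.

(** Indexing the products by all nodes makes their number the size of the circuit. *)
Lemma depth3_products :
  exists (d : node C -> nat) (A : forall j, 'M[F]_(d j, N))
      (b : forall j, 'cV[F]_(d j)) (cf : node C -> F),
    val (output C) =
      \sum_j cf j *: \prod_i affform (row i (A j)) (b j i 0).
Proof.
have /fin_all_exists [D DE] v : exists D : {d & ('M[F]_(d, N) * 'cV[F]_d)%type},
    layer v = 1%N ->
    val v = \prod_i affform (row i (tagged D).1) ((tagged D).2 i 0).
  have [/eqP/layer1_product [D DE]|/eqP lv] := boolP (layer v == 1%N).
    by exists D.
  (* Nodes outside layer 1 get an empty product; being no inputs of the output gate, they will have
     coefficient 0. *)
  by exists (existT _ 0%N (0, 0)).
have l0 : layer (output C) = 0%N by apply/eqP; rewrite layer0.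
have in1 v : v \in inputs (lab (output C)) -> layer v = 1%N.
  by move=> /layer_wire; rewrite l0.
have is_add_out : is_add (lab (output C)) by have := layer_gate (output C); rewrite l0.
exists (fun v => tag (D v)), (fun v => (tagged (D v)).1), (fun v => (tagged (D v)).2).
move: is_add_out in1; rewrite valE; case: (lab _) => //= s _ in1.
(* The coefficients of parallel wires add up. *)
exists (fun v => \sum_(cu <- s | cu.2 == v) cu.1).
under [RHS]eq_bigr do rewrite scaler_suml.
rewrite (exchange_big_dep predT) //=; apply: eq_big_seq => cu cus.
by rewrite (big_pred1 cu.2) => [|v]; [rewrite DE // in1 ?map_f | rewrite eq_sym].
Qed.

(** The output gate has an input, which lies in another layer. A size of at least 2 is what allows a
    constant power of it to absorb [n ^ n] for small [n]. *)
Lemma circuit_size_ge2 : (2 <= circuit_size C)%N.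
Proof.
have l0 : layer (output C) = 0%N by apply/eqP; rewrite layer0.
have := @circuit_internal _ _ C (output C); have := layer_gate (output C).
rewrite l0; have := layer_wire^~ (output C); rewrite /wire l0.
case: (lab _) => //= s wl _ /(_ isT); case: s wl => //= cu s wl _.
have lu := wl cu.2 (mem_head _ _).
rewrite /circuit_size (cardD1 (output C)) (cardD1 cu.2) !inE.
by have [uo|//] := eqVneq cu.2 (output C); rewrite uo l0 in lu.
Qed.

End Circuit.

Theorem depth3_lower_bound (F : finFieldType) (N n : nat) (blk : 'I_N -> 'I_n)
    (W M : finType) (P : pred W) (ltr : W -> 'I_n -> 'I_N) (e : M -> W)
    (S : {set 'I_n}) (C : circuit F N) :
  (forall w, cancel (ltr w) blk) -> (forall m, P (e m)) ->
  (forall m m', {in S, forall i, ltr (e m) i = ltr (e m') i} -> m = m') ->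
  (forall m w, P w -> {in ~: S, forall i, ltr (e m) i = ltr w i} -> e m = w) ->
  SigmaPiSigma C -> computes C (\sum_(w | P w) \prod_i 'X_(ltr w i)) ->
  (2 <= circuit_size C)%N /\ forall t,
  (#|M| <= circuit_size C * 'C(#|S| + t, #|S|))%N \/
  ((2 * #|F|) ^ t.+1 <=
     circuit_size C * 2 ^ (n + #|S|) * (2 * #|F|).-1 ^ t.+1)%N.
Proof.
move=> ltrK Pe S_inj SC_inj [layer [l0 lg lw]] [val valE outE].
split; first exact: circuit_size_ge2 l0 lg lw.
have [d [A [b [cf]]]] := depth3_products l0 lg lw valE.
rewrite outE => fE t.
exact: (@setmultilinear_depth3 _ _ _ _ _ _ _ _ e S ltrK Pe S_inj SC_inj _ _ _ _ _ t fE).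
Qed.

(** * The Nisan-Wigderson polynomial *)

Lemma card_odd_ord n : #|[set i : 'I_n | odd i]| = n./2.
Proof.
by rewrite cardsE -sum_odd_ord -sum1_card.
Qed.

Section MxvecIndex.
Variables m n : nat.

Lemma mxvec_index_inj (i i' : 'I_m) (j j' : 'I_n) :
  mxvec_index i j = mxvec_index i' j' -> i = i' /\ j = j'.
Proof. by move=> /cast_ord_inj/enum_rank_inj[-> ->]. Qed.

Definition mxvec_row (v : 'I_(m * n)) : 'I_m :=
  (enum_val (cast_ord (esym (mxvec_cast m n)) v)).1.

Lemma mxvec_rowK (i : 'I_m) (j : 'I_n) : mxvec_row (mxvec_index i j) = i.
Proof. by rewrite /mxvec_row cast_ordK enum_rankK. Qed.

End MxvecIndex.

Lemma poly_eq_on (K : fieldType) (T : finType) (pt : T -> K) (A : {set T})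
    (p p' : {poly K}) d :
  injective pt -> (size p <= d)%N -> (size p' <= d)%N -> (d <= #|A|)%N ->
  {in A, forall i, p.[pt i] = p'.[pt i]} -> p = p'.
Proof.
move=> pt_inj sp sp' leA eqA; apply/eqP; rewrite -subr_eq0.
apply/eqP/(@roots_geq_poly_eq0 _ _ [seq pt i | i <- enum A]).
- apply/allP => _ /mapP [i iA ->]; rewrite mem_enum in iA.
  by rewrite rootE hornerD hornerN eqA // subrr.
- by rewrite map_inj_uniq ?enum_uniq.
rewrite size_map -cardE; apply: leq_trans leA.
by rewrite (leq_trans (size_polyD _ _)) // size_polyN geq_max sp.
Qed.

(** [M] consists of the polynomials of size at most [n./2], determined by their values at the [n./2]
    odd indices. All words have size at most [n - n./2], the number of even indices, and are
    determined by their values there. *)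
Lemma NW_lower_bound (F : finFieldType) (R : realFieldType) (n : nat)
    (K : finFieldType) (elt : 'I_n -> K) (idx : K -> 'I_n) (C : circuit F (n * n)) :
  cancel elt idx -> cancel idx elt ->
  SigmaPiSigma C -> computes C (NW F elt idx (2^-1 : R)) ->
  (2 <= circuit_size C)%N /\ forall t,
  (n ^ n./2 <= circuit_size C * 'C(n./2 + t, n./2))%N \/
  ((2 * #|F|) ^ t.+1 <=
     circuit_size C * 2 ^ (n + n./2) * (2 * #|F|).-1 ^ t.+1)%N.
Proof.
move=> eltK idxK; set S := [set i : 'I_n | odd i].
have cK : #|K| = n by rewrite -(bij_eq_card (Bijective eltK idxK)) card_ord.
have n_gt0 : (0 < n)%N by rewrite -cK; apply/card_gt0P; exists 0.
pose ltr (a : {poly_n K}) i := mxvec_index i (idx (val a).[elt i]).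
pose e (m : {poly_(n./2) K}) : {poly_n K} := npolyp n (val m).
have ltrE (a a' : {poly_n K}) i : ltr a i = ltr a' i -> (val a).[elt i] = (val a').[elt i].
  by move=> /mxvec_index_inj [_ /(can_inj idxK)].
have eE m : val (e m) = val m.
  by apply: npolypK; rewrite (leq_trans (size_npoly m)) // leq_half_double; lia.
have PE (a : {poly_n K}) :
    ((size a).-1%:R < 2^-1 * n%:R :> R) = (size (val a) <= n - n./2)%N.
  rewrite mulrC ltr_pdivlMr ?ltr0n // -natrM ltr_nat.
  by move: (size _) => s; apply/idP/idP; lia.
have elt_inj := can_inj eltK.
rewrite -(card_odd_ord n) -/S.
have -> : (n ^ #|S|)%N = #|{poly_(n./2) K}| by rewrite card_npoly cK card_odd_ord.
move=> SC comp.
apply: (@depth3_lower_bound F _ _ (@mxvec_row n n) _ _ _ ltr e S C _ _ _ _ SC comp).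
- by move=> w i; apply: mxvec_rowK.
- by move=> m /=; rewrite PE eE (leq_trans (size_npoly m)) //; lia.
- move=> m m' eq_e; apply: val_inj.
  apply: (poly_eq_on elt_inj (size_npoly m) (size_npoly m') (A := S)).
    by rewrite card_odd_ord.
  by move=> i /eq_e /ltrE; rewrite !eE.
move=> m a; rewrite PE => sa eq_e; apply: val_inj.
apply: (poly_eq_on elt_inj _ sa (A := ~: S)).
- by rewrite eE (leq_trans (size_npoly m)) //; lia.
- by rewrite cardsCs setCK card_ord card_odd_ord.
by move=> i /eq_e /ltrE.
Qed.

(** * Iterated matrix multiplication *)

(** The words are the walks of length [m] from [i] to [j]. Induction removes the first matrix, and
    [cons] puts the vertex [i] back in front of a walk. *)
Lemma mulmx_big_entry (A : pzRingType) (n m : nat) (X : 'I_m -> 'M[A]_n) i j :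
  (\big[mulmx/1%:M]_(k < m) X k) i j =
  \sum_(w : {ffun 'I_m.+1 -> 'I_n} | (w ord0 == i) && (w ord_max == j))
    \prod_(k < m) X k (w (widen_ord (leqnSn m) k)) (w (lift ord0 k)).
Proof.
elim: m X i => [|m IHm] X i.
  rewrite big_ord0 mxE.
  have max0 : ord_max = ord0 :> 'I_1 by apply: val_inj.
  have [<-|ij] := eqVneq i j.
    rewrite (big_pred1 [ffun=> i]) ?big_ord0 // => w.
    rewrite /= max0 andbb; apply/eqP/eqP => [w0|->]; last by rewrite ffunE.
    by apply/ffunP => k; rewrite ffunE (ord1 k).
  rewrite big1 // => w /andP[/eqP w0 /eqP w1].
  by move: ij; rewrite -w0 -w1 max0 eqxx.
rewrite big_ord_recl mxE.
pose cons (w : {ffun 'I_m.+1 -> 'I_n}) : {ffun 'I_m.+2 -> 'I_n} :=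
  [ffun k => if unlift ord0 k is Some k' then w k' else i].
have cons0 w : cons w ord0 = i by rewrite ffunE unlift_none.
have consS w k : cons w (lift ord0 k) = w k by rewrite ffunE liftK.
have max_lift : ord_max = lift ord0 ord_max :> 'I_m.+2 by apply: val_inj.
rewrite [RHS](reindex_onto cons (fun w => [ffun k => w (lift ord0 k)])) /=; last first.
  move=> w /andP[/eqP w0 _]; apply/ffunP => k.
  by case: (unliftP ord0 k) => [k' ->|->]; rewrite ?consS ?cons0 ?ffunE.
rewrite (eq_bigl (fun w : {ffun _} => w ord_max == j)) => [|w]; last first.
  rewrite cons0 eqxx max_lift consS /=; apply/andb_idr => _.
  by apply/eqP/ffunP => k; rewrite ffunE consS.
rewrite (partition_big (fun w : {ffun 'I_m.+1 -> 'I_n} => w ord0) predT) //=.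
apply: eq_bigr => l _; rewrite IHm mulr_sumr.
apply: eq_big => [w|w /andP[/eqP w0 _]]; first by rewrite andbC.
rewrite big_ord_recl.
have -> : widen_ord (leqnSn m.+1) ord0 = ord0 by apply: val_inj.
rewrite cons0 consS w0; congr (_ * _); apply: eq_bigr => k _.
have -> : widen_ord (leqnSn m.+1) (lift ord0 k) = lift ord0 (widen_ord (leqnSn m) k).
  exact: val_inj.
by rewrite !consS.
Qed.

(** A letter in block [i] is the edge from vertex [i] to vertex [i + 1] of a closed walk at [z]. Odd
    blocks reveal the odd vertices, the only free ones in [e h]; even blocks reveal all vertices but
    the last, which is [z]. *)
Lemma IMM_lower_bound (F : finFieldType) (n : nat) (n_gt0 : (0 < n)%N)
    (C : circuit F (n * (n * n))) : ~~ odd n ->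
  SigmaPiSigma C -> computes C (IMM F n_gt0) ->
  (2 <= circuit_size C)%N /\ forall t,
  (n ^ n./2 <= circuit_size C * 'C(n./2 + t, n./2))%N \/
  ((2 * #|F|) ^ t.+1 <=
     circuit_size C * 2 ^ (n + n./2) * (2 * #|F|).-1 ^ t.+1)%N.
Proof.
move=> n_even; set S := [set i : 'I_n | odd i]; pose z := Ordinal n_gt0.
pose src (i : 'I_n) := widen_ord (leqnSn n) i.
pose ltr (w : {ffun 'I_n.+1 -> 'I_n}) (i : 'I_n) :=
  mxvec_index i (mxvec_index (w (src i)) (w (lift ord0 i))).
(* Vertex [2j + 1] is [h j] and even vertices are [z], including the last since [n] is even. The
   default of [oapp] is never reached. *)
pose e (h : {ffun 'I_(n./2) -> 'I_n}) : {ffun 'I_n.+1 -> 'I_n} :=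
  [ffun v : 'I_n.+1 => if odd v then oapp h z (insub v./2) else z].
have ltrE w w' i : ltr w i = ltr w' i ->
    w (src i) = w' (src i) /\ w (lift ord0 i) = w' (lift ord0 i).
  by move=> /mxvec_index_inj [_ /mxvec_index_inj].
rewrite -(card_odd_ord n) -/S.
have -> : (n ^ #|S|)%N = #|{ffun 'I_(n./2) -> 'I_n}|.
  by rewrite card_ffun !card_ord card_odd_ord.
rewrite /IMM mulmx_big_entry => SC.
under eq_bigr do under eq_bigr do rewrite mxE.
move=> comp.
apply: (@depth3_lower_bound F _ _ (@mxvec_row n (n * n)) _ _ _ ltr e S C _ _ _ _ SC comp).
- by move=> w i; apply: mxvec_rowK.
- by move=> h /=; rewrite !ffunE /= (negbTE n_even) !eqxx.
- move=> h h' eq_e; apply/ffunP => j.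
  have ltj : (j.*2.+1 < n)%N by have := ltn_ord j; lia.
  have /eq_e /ltrE [] : Ordinal ltj \in S by rewrite inE /= odd_double.
  by rewrite !ffunE /= odd_double /= uphalf_double valK.
move=> h w /andP[/eqP w0 /eqP wn] eq_e; apply/ffunP => v.
have [->|vn] := eqVneq v ord_max.
  by rewrite wn ffunE /= (negbTE n_even).
have ltv : (v < n)%N.
  by rewrite ltn_neqAle -ltnS ltn_ord andbT; apply: contra vn => /eqP vE; apply/eqP/val_inj.
(* An even vertex is the source of the edge in block [v], an odd one the target of the edge in block
   [v.-1]; either block is even. *)
have [v_odd|v_even] := boolP (odd v); last first.
  have /eq_e /ltrE [+ _] : Ordinal ltv \in ~: S by rewrite !inE.
  by rewrite (_ : src _ = v) //; apply: val_inj.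
have ltv' : (v.-1 < n)%N by apply: leq_ltn_trans (leq_pred _) ltv.
have /eq_e /ltrE [_] : Ordinal ltv' \in ~: S.
  by rewrite !inE /= -subn1 oddB ?v_odd //; case: (nat_of_ord v) v_odd.
rewrite (_ : lift _ _ = v) //; apply: val_inj; rewrite /= /bump /= add1n prednK //.
by case: (nat_of_ord v) v_odd.
Qed.

(** * Numerical estimates *)

(** Bernoulli's inequality for [(1 + 1 / m) ^ m.+1]. With [m = (2 * q).-1], every [2 * q] factors
    [2 * q / (2 * q).-1] gain a factor 2. *)
Lemma expn_succ_ge_double m : (2 * m ^ m.+1 <= m.+1 ^ m.+1)%N.
Proof.
have bernoulli k : (m ^ k * (m + k) <= m.+1 ^ k * m)%N.
  elim: k => [|k IHk]; first by rewrite addn0.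
  rewrite !expnS -mulnA; apply: (@leq_trans (m.+1 * (m ^ k * (m + k)))).
    by move: (m ^ k)%N => a; nia.
  by rewrite -mulnA leq_mul2l IHk orbT.
have [->|m_gt0] := posnP m; first by [].
rewrite -(leq_pmul2r m_gt0); apply: leq_trans (bernoulli m.+1).
by move: (m ^ m.+1)%N => a; nia.
Qed.

Lemma bin_double_le k : ('C(k.*2, k) <= 4 ^ k)%N.
Proof.
have -> : (4 ^ k = 2 ^ k.*2)%N by rewrite -mul2n expnM.
rewrite -[in leqRHS](addn1 1) expnDn.
have lt : (k < k.*2.+1)%N by lia.
by rewrite (bigD1 (Ordinal lt)) //= !exp1n ?mul1n ?muln1 leq_addr.
Qed.

(** This rests on [k ^ k <= 4 ^ k * k!], obtained by bounding [(k + k) ^_ k = 'C(k.*2, k) * k!] on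
    both sides. *)
Lemma bin_expn_le k t : ('C(k + t, k) * k ^ k <= (4 * (k + t)) ^ k)%N.
Proof.
have ffact_ge j : (j <= k -> k ^ j <= (k + k) ^_ j)%N.
  elim: j => // j IHj ltjk; rewrite expnSr ffactnSr leq_mul ?IHj //; lia.
have ffact_le j : ((k + t) ^_ j <= (k + t) ^ j)%N.
  elim: j => // j IHj; rewrite expnSr ffactnSr leq_mul ?leq_subr //.
apply: (@leq_trans ('C(k + t, k) * (4 ^ k * k`!))).
  rewrite leq_mul2l; apply/orP; right.
  apply: leq_trans (ffact_ge k (leqnn k)) _.
  by rewrite -bin_ffact leq_mul2r addnn bin_double_le orbT.
by rewrite mulnCA bin_ffact expnMn leq_mul2l ffact_le orbT.
Qed.

Lemma cube_le_exp2 l : (10 <= l -> l ^ 3 <= 2 ^ l)%N.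
Proof.
elim: l => // l IHl; rewrite leq_eqVlt => /orP[/eqP <- //|].
rewrite ltnS => l10; rewrite [leqRHS]expnS.
by apply: leq_trans (leq_mul (leqnn 2%N) (IHl l10)); nia.
Qed.

(** A single well-chosen [t] suffices for each large [n]. The condition [1 < D] is there to make the
    exponent [1 / D] less than 1. *)
Lemma alternative_growth q : (3 <= q)%N -> exists2 D : nat, (1 < D)%N &
  forall n s : nat, (0 < n)%N -> (2 <= s)%N ->
  (forall t,
    (n ^ n./2 <= s * 'C(n./2 + t, n./2))%N \/
    ((2 * q) ^ t.+1 <= s * 2 ^ (n + n./2) * (2 * q).-1 ^ t.+1)%N) ->
  (n ^ n <= s ^ D)%N.
Proof.
move=> q3; pose l0 := (3600 * q ^ 2)%N; pose n0 := (2 ^ l0)%N.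
(* Below n0 the bound n ^ n <= 2 ^ n0 ^ 2 <= s ^ n0 ^ 2 is enough; above it,
   l0 ensures (60 * q * l) ^ 2 <= 2 ^ l <= n for l = trunc_log 2 n. *)
exists (6 + n0 ^ 2)%N => // n s n_gt0 s2 alt.
have s_gt0 : (0 < s)%N by apply: ltn_trans s2.
have [lt_n|le_n] := ltnP n n0.
  apply: (@leq_trans (2 ^ (n * n))).
    by rewrite expnM leq_exp2r // ltnW // ltn_expl.
  apply: (@leq_trans (s ^ (n * n))); first by rewrite leq_exp2r // muln_gt0 n_gt0.
  by rewrite leq_pexp2l // (leq_trans _ (leq_addl _ _)) // -mulnn leq_mul // ltnW.
apply: (@leq_trans (s ^ 6)); last by rewrite leq_pexp2l // leq_addr.
pose l := trunc_log 2 n; pose k := n./2.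
have l0l : (l0 <= l)%N by apply: trunc_log_max.
have l10 : (10 <= l)%N by apply: leq_trans l0l; rewrite /l0; nia.
have le_nl : (2 ^ l <= n)%N by apply: trunc_logP.
have lt_nl : (n < 2 ^ l.+1)%N by apply: trunc_log_ltn.
have n2 : (2 <= n)%N by apply: leq_trans le_nl; rewrite -{1}(expn1 2) leq_exp2l //; lia.
have n3k : (n <= 3 * k)%N by rewrite /k; lia.
(* [T] stands for [t.+1]. It gains [2 ^ (2 * n * l)] in the second alternative, enough to beat
   [2 ^ (n + k)], yet keeps [T / k] of order [q * l] in the first. *)
pose T := (2 * q * (2 * n * l))%N.
have T_gt0 : (0 < T)%N by rewrite /T !muln_gt0; lia.
case: (alt T.-1); rewrite ?(prednK T_gt0) -/k => H.
  (* Here the binomial is at most [(60 * q * l) ^ k], whose square is at most [n ^ k]; squaring the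
     alternative cancels one factor [n ^ k]. *)
  suff nk : (n ^ k <= s ^ 2)%N.
    apply: (@leq_trans (n ^ (3 * k))); first by rewrite leq_pexp2l.
    by rewrite mulnC expnM (_ : 6 = 2 * 3)%N // [leqRHS]expnM leq_exp2r.
  have le1 : (n ^ k * k ^ k <= s * (60 * q * l) ^ k * k ^ k)%N.
    apply: leq_trans (leq_mul H (leqnn _)) _; rewrite -!mulnA leq_mul2l.
    apply/orP; right; apply: leq_trans (bin_expn_le _ _) _.
    have [->|k_gt0] := posnP k; first by [].
    rewrite -expnMn leq_exp2r //.
    have : (k <= n)%N by rewrite /k; lia.
    have : (T = 4 * (q * l) * n)%N by rewrite /T; lia.
    have : (0 < q * l)%N by rewrite muln_gt0; lia.
    by move: (q * l)%N => a a_gt0 -> kn; nia.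
  have k_gt0 : (0 < k)%N by rewrite /k; lia.
  rewrite leq_pmul2r ?expn_gt0 ?k_gt0 // in le1.
  have le2 : ((60 * q * l) ^ 2 <= n)%N.
    apply: leq_trans le_nl; apply: leq_trans (cube_le_exp2 l10).
    rewrite (_ : (60 * q * l) ^ 2 = l0 * l ^ 2)%N; last by rewrite /l0 -!mulnn; lia.
    by rewrite [leqRHS]expnS leq_mul2r l0l orbT.
  have nk_gt0 : (0 < n ^ k)%N by rewrite expn_gt0 n_gt0.
  rewrite -(leq_pmul2r nk_gt0) mulnn.
  apply: (@leq_trans ((s * (60 * q * l) ^ k) ^ 2)); first by rewrite leq_exp2r.
  by rewrite expnMn leq_mul2l -expnM (mulnC k) expnM leq_exp2r // le2 orbT.
have double : (2 ^ (2 * n * l) * (2 * q).-1 ^ T <= (2 * q) ^ T)%N.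
  have E_gt0 : (0 < 2 * n * l)%N by rewrite !muln_gt0 n_gt0; lia.
  rewrite /T !(expnM _ (2 * q)%N (2 * n * l)%N) -expnMn leq_exp2r //.
  have := expn_succ_ge_double (2 * q).-1.
  by rewrite prednK //; lia.
have le1 : (2 ^ (2 * n * l) <= s * 2 ^ (n + k))%N.
  have p_gt0 : (0 < (2 * q).-1 ^ T)%N by rewrite expn_gt0; lia.
  by rewrite -(leq_pmul2r p_gt0); exact: (leq_trans double H).
have le_s : (2 ^ (n * l) <= s)%N.
  rewrite -(@leq_pmul2r (2 ^ (n + k))) ?expn_gt0 //; apply: leq_trans le1.
  by rewrite -expnD leq_exp2l // /k; nia.
apply: (@leq_trans ((2 ^ (n * l)) ^ 2)).
  rewrite -expnM -mulnA mulnC expnM leq_exp2r //.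
  by apply: leq_trans (ltnW lt_nl) _; rewrite leq_exp2l //; lia.
apply: (@leq_trans (s ^ 2)); first by rewrite leq_exp2r.
by rewrite leq_pexp2l.
Qed.

(** Taking logarithms, the hypothesis reads [n * ln n <= D * ln s]; the factor [ln 2] cancels in the
    exponent of [2]. *)
Lemma powR_le_of_expn (R : realType) (n s D : nat) :
  (0 < n)%N -> (0 < s)%N -> (0 < D)%N -> (n ^ n <= s ^ D)%N ->
  2 `^ (D%:R^-1 * n%:R * (ln n%:R / ln 2)) <= s%:R :> R.
Proof.
move=> n_gt0 s_gt0 D_gt0 le_ns.
have ln2 : 0 < ln (2 : R) by rewrite ln_gt0 // ltr1n.
rewrite /powR pnatr_eq0 /= mulrA divfK ?gt_eqF //.
rewrite -[leRHS]lnK ?posrE ?ltr0n // ler_expR.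
rewrite -mulrA mulrC ler_pdivrMr ?ltr0n //.
rewrite mulr_natl -lnXn ?ltr0n // mulr_natr -lnXn ?ltr0n //.
by rewrite ler_ln ?posrE ?exprn_gt0 ?ltr0n // -!natrX ler_nat.
Qed.

Theorem theorem2 (R : realType) (q : nat) (q_ge3 : (3 <= q)%N) :
  exists eps delta : R,
    [/\ 0 < eps < 1, 0 < delta < 1 &
    forall (F : finFieldType), #|F| = q ->
      (forall (n p k : nat), prime p -> (0 < k)%N -> n = (p ^ k)%N ->
        forall (K : finFieldType), #|K| = n ->
        forall (elt : 'I_n -> K) (idx : K -> 'I_n),
        cancel elt idx -> cancel idx elt ->
        forall C : circuit F (n * n),
          SigmaPiSigma C -> computes C (NW F elt idx eps) ->
          2 `^ (delta * n%:R * (ln n%:R / ln 2)) <= (circuit_size C)%:R) /\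
      (forall (n : nat) (n_gt0 : (0 < n)%N), ~~ odd n ->
        forall C : circuit F (n * (n * n)),
          SigmaPiSigma C -> computes C (IMM F n_gt0) ->
          2 `^ (delta * n%:R * (ln n%:R / ln 2)) <= (circuit_size C)%:R)].
Proof.
have [D D_gt1 growth] := alternative_growth q_ge3.
have D_gt0 : (0 < D)%N by apply: ltnW.
(* [D] comes from [q] alone, so [delta] is fixed before the field [F] and [n]. *)
exists 2^-1, D%:R^-1; split.
- by rewrite invr_gt0 ltr0n invf_lt1 ?ltr1n ?ltr0n.
- by rewrite invr_gt0 ltr0n D_gt0 invf_lt1 ?ltr1n ?ltr0n.
move=> F cardF; split.
  move=> n p k p_prime k_gt0 nE K cK elt idx eltK idxK C SC comp.
  have [s2 alt] := NW_lower_bound eltK idxK SC comp.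
  have n_gt0 : (0 < n)%N by rewrite nE expn_gt0 prime_gt0.
  apply: powR_le_of_expn => //; first exact: ltnW.
  by apply: growth => // t; rewrite -cardF; apply: alt.
move=> n n_gt0 n_even C SC comp.
have [s2 alt] := IMM_lower_bound n_even SC comp.
apply: powR_le_of_expn => //; first exact: ltnW.
by apply: growth => // t; rewrite -cardF; apply: alt.
Qed.
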